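(* For every integer $M \geq 1$, the number of partitions into distinct parts with perimeter $M$ equals the number of partitions into odd parts with perimeter $M$, and both numbers equal the Fibonacci number $F_M$.
   Context: A partition $\lambda = (\lambda_1, \ldots, \lambda_\ell)$ is a finite weakly decreasing sequence of positive integers. A partition into distinct parts has $\lambda_1 > \cdots > \lambda_\ell$; a partition into odd parts has all $\lambda_i$ odd. The perimeter of a nonempty partition is $\lambda_1 + \ell - 1$ (the largest part plus the number of parts minus $1$, equivalently the maximum hook length in its Young diagram); the empty partition has perimeter $0$. The Fibonacci numbers are defined by $F_0 = 0$, $F_1 = 1$, $F_{n} = F_{n-1} + F_{n-2}$. *)

(* Defs.v *)
From mathcomp Require Import all_boot.
From mathcomp Require Import boolp classical_sets cardinality.

Set Implicit Arguments.
Unset Strict Implicit.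
Unset Printing Implicit Defensive.

Local Open Scope classical_set_scope.

Definition is_partition (l : seq nat) : bool :=
  sorted geq l && all (fun x => 0 < x) l.

Definition distinct_parts (l : seq nat) : bool := sorted gtn l.

Definition odd_parts (l : seq nat) : bool := all odd l.

Definition perimeter (l : seq nat) : nat :=
  if l is x :: _ then x + size l - 1 else 0.

Definition distinct_partitions (M : nat) : set (seq nat) :=
  [set l | is_partition l /\ distinct_parts l /\ perimeter l = M].

Definition odd_partitions (M : nat) : set (seq nat) :=
  [set l | is_partition l /\ odd_parts l /\ perimeter l = M].

Fixpoint fib (n : nat) : nat :=
  match n with
  | 0 => 0
  | n'.+1 => if n' is n''.+1 then fib n' + fib n'' else 1
  end.

(* Main.v *)
Require Import Defs.
From mathcomp Require Import all_boot.
From mathcomp Require Import boolp classical_sets cardinality.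
From mathcomp Require Import zify.

Local Open Scope classical_set_scope.
Local Open Scope card_scope.

(* Both families satisfy the Fibonacci recurrence.  A distinct partition of
   perimeter n+2 arises either by increasing the largest part of one of
   perimeter n+1 by 1, or, when its two largest parts are consecutive, by
   adding a new largest part to one of perimeter n.  An odd partition of
   perimeter n+2 arises either by repeating the largest part of one of
   perimeter n+1, or, when its largest part is not repeated, by increasing the
   largest part of one of perimeter n by 2. *)

Lemma card_eq_uniq_seq (T : eqType) (s : seq T) :
  uniq s -> [set` s] #= `I_(size s).
Proof.
(* A nonempty list supplies the default element for [nth], which is then the bijection from indices
   to members. *)
case: s => [_|x0 s]; first by rewrite set_nil /= II0.
set t := x0 :: s => Ut.
have <- : nth x0 t @` `I_(size t) = [set` t].
  apply/seteqP; split=> x /=; first by move=> [i ilt <-]; apply: mem_nth.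
  by move=> xt; exists (index x t); [rewrite -index_mem in xt | exact: nth_index].
apply: inj_card_eq => i j; rewrite !inE /= => ilt jlt /eqP.
by rewrite nth_uniq // => /eqP.
Qed.

(** Injectivity and disjointness of the images make the sizes add. Indices start at 1 because the
    only partition of perimeter 0 is the empty one, whereas [fib 0] is 0. *)
Lemma card_eq_fib (T : eqType) (A : nat -> set T) (f g : T -> T) (a b : T) :
  injective f -> injective g ->
  (forall n x y, A n.+2 x -> A n.+1 y -> f x <> g y) ->
  A 1 = [set a] -> A 2 = [set b] ->
  (forall n, A n.+3 = f @` A n.+2 `|` g @` A n.+1) ->
  forall n, A n.+1 #= `I_(fib n.+1).
Proof.
move=> f_inj g_inj fg_disjoint A1 A2 A_rec n.
(* The recurrence reaches back two steps, so the induction carries duplicate-free enumerations of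
   two consecutive sets. *)
suff [[s [Us <- ->]] _] :
    (exists s, [/\ uniq s, size s = fib n.+1 & A n.+1 = [set` s]]) /\
    (exists s, [/\ uniq s, size s = fib n.+2 & A n.+2 = [set` s]]).
  exact: card_eq_uniq_seq.
elim: n => [|n [[s [Us Ss As]] [t [Ut St At]]]].
  split; [exists [:: a] | exists [:: b]]; split=> //; rewrite ?A1 ?A2.
    by apply/seteqP; split=> x /=; rewrite inE => /eqP.
  by apply/seteqP; split=> x /=; rewrite inE => /eqP.
split; first by exists t.
exists (map f t ++ map g s); split.
- rewrite cat_uniq !map_inj_uniq // Ut Us andbT /=.
  apply/hasPn => _ /mapP[y ys ->]; apply/mapP => -[x xt] /esym.
  by apply: (@fg_disjoint n); rewrite ?At ?As.
- by rewrite size_cat !size_map St Ss.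
- rewrite A_rec At As; apply/seteqP; split=> z /=.
    by rewrite mem_cat => -[[x xt <-]|[x xs <-]]; rewrite map_f ?orbT.
  by rewrite mem_cat => /orP[]/mapP[x xs ->]; [left|right]; exists x.
Qed.

Definition raise_head (k : nat) (l : seq nat) : seq nat :=
  if l is x :: l' then (x + k) :: l' else [::].

(** With [k = 0] the largest part is repeated; with [k = 1] a new largest part, one above the old,
    is added. *)
Definition cons_head (k : nat) (l : seq nat) : seq nat := (head 0 l + k) :: l.

Lemma raise_head_inj k : injective (raise_head k).
Proof. by move=> [|x l] [|y m] //= [/addIn -> ->]. Qed.

Lemma cons_head_inj k : injective (cons_head k).
Proof. by move=> l m []. Qed.

Lemma distinct_partitionsE M x l :
  distinct_partitions M (x :: l) <->
  [/\ path gtn x l, all (fun i => 0 < i) (x :: l) & x + size l = M].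
Proof.
rewrite /distinct_partitions /is_partition /distinct_parts /=; split.
  by move=> [/andP[_ ->] [-> <-]]; split=> //; lia.
move=> [xl -> <-]; rewrite andbT; split; last by split=> //; lia.
by apply: sub_path xl => i j /=; lia.
Qed.

Lemma odd_partitionsE M x l :
  odd_partitions M (x :: l) <->
  [/\ path geq x l, all odd (x :: l) & x + size l = M].
Proof.
rewrite /odd_partitions /is_partition /odd_parts /=; split.
  by move=> [/andP[-> _] [-> <-]]; split=> //; lia.
move=> [-> oddl <-]; split; last by split=> //; lia.
by apply: (@sub_all _ odd _ _ (x :: l)) oddl => -[].
Qed.

Lemma distinct_partitions1 : distinct_partitions 1 = [set [:: 1]].
Proof.
apply/seteqP; split=> [[|x [|y l]]|_ ->] /=; rewrite ?distinct_partitionsE //=.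
- by move=> [_ []].
- by move=> [_ _]; rewrite addn0 => ->.
- by move=> [_ /andP[]]; lia.
Qed.

Lemma distinct_partitions2 : distinct_partitions 2 = [set [:: 2]].
Proof.
apply/seteqP; split=> [[|x [|y l]]|_ ->] /=; rewrite ?distinct_partitionsE //=.
- by move=> [_ []].
- by move=> [_ _]; rewrite addn0 => ->.
- by move=> [/andP[+ _] /and3P[]]; lia.
Qed.

Lemma odd_partitions1 : odd_partitions 1 = [set [:: 1]].
Proof.
apply/seteqP; split=> [[|x [|y l]]|_ ->] /=; rewrite ?odd_partitionsE //=.
- by move=> [_ []].
- by move=> [_ _]; rewrite addn0 => ->.
- by move=> [_ /andP[]]; case: x => //=; lia.
Qed.

Lemma odd_partitions2 : odd_partitions 2 = [set [:: 1; 1]].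
Proof.
apply/seteqP; split=> [[|x [|y [|z l]]]|_ ->] /=; rewrite ?odd_partitionsE //=.
- by move=> [_ []].
- by rewrite addn0 => -[_ + xE]; rewrite xE.
- move=> [/andP[+ _] /and3P[ox oy _] xE].
  have -> : x = 1 by lia.
  by case: y oy => [|[|y]].
- by move=> [_ /andP[]]; case: x => //=; lia.
Qed.

Lemma distinct_partitions_rec n :
  distinct_partitions n.+3 =
  raise_head 1 @` distinct_partitions n.+2 `|`
  cons_head 1 @` distinct_partitions n.+1.
Proof.
apply/seteqP; split.
  case=> [|x l]; first by move=> [_ []].
  rewrite distinct_partitionsE => -[xl /= /andP[x0 l0] xE].
  (* For a single part the default 0 would put [x = 1] in the first case, which perimeter at least 3
     excludes. *)
  have [xhd|xhd] := eqVneq x (head 0 l).+1.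
    right; case: l xl l0 xE xhd => [|y l] /= xl l0 xE xhd; first lia.
    exists (y :: l); last by rewrite /cons_head /= xhd addn1.
    by apply/distinct_partitionsE; split=> //; [case/andP: xl | lia].
  (* Here [x] exceeds the next part by at least 2, so lowering it by 1 keeps the parts distinct. *)
  left; exists (x.-1 :: l); last by rewrite /= addn1 prednK.
  apply/distinct_partitionsE; case: l xl l0 xE xhd => [|y l] /=.
    by split=> //; lia.
  by move=> /andP[yx yl] /andP[y0 l0] xE xhd; split; rewrite ?yl ?y0 ?l0; lia.
move=> _ [][[|x l]] + <-; rewrite /= ?distinct_partitionsE; try by case=> _ [].
- move=> [xl /= /andP[x0 l0] xE] /=.
  split; [|by rewrite /= l0; lia|by lia].
  by case: l xl {l0 xE} => //= y l /andP[yx ->]; lia.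
- move=> [xl /= l0 xE] /=.
  by rewrite xl l0; split; lia.
Qed.

Lemma odd_partitions_rec n :
  odd_partitions n.+3 =
  cons_head 0 @` odd_partitions n.+2 `|` raise_head 2 @` odd_partitions n.+1.
Proof.
apply/seteqP; split.
  case=> [|x l]; first by move=> [_ []].
  rewrite odd_partitionsE => -[xl /= /andP[x0 l0] xE].
  have [xhd|xhd] := eqVneq x (head 0 l).
    left; case: l xl l0 xE xhd => [|y l] /= xl l0 xE xhd; first lia.
    exists (y :: l); last by rewrite /cons_head /= xhd addn0.
    by apply/odd_partitionsE; split=> //; [case/andP: xl | lia].
  (* A single part equals the perimeter, at least 3. Otherwise [x] exceeds an odd part and is itself
     odd, so the gap is at least 2; hence also [x - 2] stays at or above the next part. *)
  have x3 : 2 < x.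
    by case: l xl l0 xE xhd => [|y l] /=; lia.
  right; exists (x - 2 :: l); last by rewrite /= subnK // ltnW.
  apply/odd_partitionsE; case: l xl l0 xE xhd => [|y l] /=.
    by split=> //; lia.
  by move=> /andP[yx yl] /andP[oy ol] xE xhd; split; rewrite ?yl ?ol; lia.
move=> _ [][[|x l]] + <-; rewrite /= ?odd_partitionsE; try by case=> _ [].
- move=> [xl /= /andP[x0 l0] xE] /=.
  by rewrite xl l0; split; lia.
- move=> [xl /= /andP[x0 l0] xE] /=.
  split; [|by rewrite /= l0; lia|by lia].
  by case: l xl {l0 xE} => //= y l /andP[yx ->]; lia.
Qed.

Lemma card_distinct_partitions n : distinct_partitions n.+1 #= `I_(fib n.+1).
Proof.
apply: (@card_eq_fib _ distinct_partitions (raise_head 1) (cons_head 1)).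
- exact: raise_head_inj.
- exact: cons_head_inj.
- move=> m [|x l] [|y k]; rewrite ?distinct_partitionsE; try by case=> _ [].
    by move=> _ [_ []].
  (* A common image would give [x = y] with [y] the head of [l], against the strict decrease of
     [x :: l]. *)
  by move=> [xl _ _] _ [xy lE]; move: xl; rewrite lE /=; lia.
- exact: distinct_partitions1.
- exact: distinct_partitions2.
- exact: distinct_partitions_rec.
Qed.

Lemma card_odd_partitions n : odd_partitions n.+1 #= `I_(fib n.+1).
Proof.
apply: (@card_eq_fib _ odd_partitions (cons_head 0) (raise_head 2)).
- exact: cons_head_inj.
- exact: raise_head_inj.
- move=> m [|x l] [|y k]; rewrite ?odd_partitionsE; try by case=> _ [].
  (* A common image would make [x = y + 2] the head of [k], larger than the part [y] before it. *)
  by move=> _ [yk _ _] [xy lE]; move: yk; rewrite -lE /=; lia.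
- exact: odd_partitions1.
- exact: odd_partitions2.
- exact: odd_partitions_rec.
Qed.

Theorem theorem4 (M : nat) (hM : 1 <= M) :
  [/\ distinct_partitions M #= odd_partitions M,
      distinct_partitions M #= `I_(fib M)
    & odd_partitions M #= `I_(fib M)].
Proof.
case: M hM => // n _.
have D := card_distinct_partitions n; have O := card_odd_partitions n.
by split=> //; apply: card_eq_trans D _; rewrite card_eq_sym.
Qed.
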